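(* Let $S$ be a subring of a finite ring $R$. Then $\Pr(R)\le \Pr(S,R)\le \Pr(S)$.
   Context: Rings are associative and are not required to have an identity; a subring is an additive subgroup closed under multiplication. For a subring $S$ of a finite ring $R$, $\Pr(S,R)=\dfrac{|\{(s,r)\in S\times R: sr=rs\}|}{|S|\,|R|}$, and for any finite ring $T$, $\Pr(T)=\Pr(T,T)=\dfrac{|\{(s,r)\in T\times T: sr=rs\}|}{|T|^2}$. *)

(* Defs.v *)
From HB Require Import structures.
From mathcomp Require Import all_boot all_order all_algebra.

Set Implicit Arguments.
Unset Strict Implicit.
Unset Printing Implicit Defensive.

Import GRing.Theory.
Local Open Scope ring_scope.

(* MathComp's ring structures all carry a unit, so associative rings without a
   required identity are introduced on top of the additive groups. *)
HB.mixin Record Zmodule_isRng R of GRing.Zmodule R := {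
  rmul : R -> R -> R;
  rmulA : associative rmul;
  rmulDl : left_distributive rmul +%R;
  rmulDr : right_distributive rmul +%R
}.

#[short(type="rngType")]
HB.structure Definition Rng := {R of Zmodule_isRng R & GRing.Zmodule R}.

#[short(type="finRngType")]
HB.structure Definition FinRng := {R of Rng R & Finite R}.

Notation "x ** y" := (rmul x y) (at level 40, left associativity) : ring_scope.

Definition subring (R : finRngType) (S : {set R}) : Prop :=
  zmod_closed S /\ {in S &, forall x y, x ** y \in S}.

(* Rings are represented by subrings of an ambient finite ring, the ambient
   ring itself being [set: R]; the operations of S are those of R. *)
Definition relPr (R : finRngType) (S T : {set R}) : rat :=
  #|[set p in setX S T | p.1 ** p.2 == p.2 ** p.1]|%:R / (#|S|%:R * #|T|%:R).

Definition Pr (R : finRngType) (T : {set R}) : rat := relPr T T.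

(* Main.v *)
Require Import Defs.
From mathcomp Require Import all_boot all_order all_algebra.

(** Fix an element [t] and let [C] be its centralizer in [R], an additive
    subgroup. The additive group [R] contains [S + C], whose order is
    [#|S| * #|C| / #|S :&: C|]; hence the proportion of elements commuting with
    [t] is at least as large in [S] as in [R]
    ([leq_card_zmod_closedI]). Averaging over the [t] in any subset [T] gives
    [relPr [set: R] T <= relPr S T] ([relPr_setT_le]). The first inequality is
    the case [T = [set: R]]; the second is the case [T = S], since [relPr] is
    symmetric in its two arguments ([relPrC]). *)

Import GRing.Theory Num.Theory.
Local Open Scope ring_scope.

Definition centralizer (R : finRngType) (t : R) : {set R} :=
  [set s | s ** t == t ** s].

Lemma centralizer_zmod_closed (R : finRngType) (t : R) :
  zmod_closed (centralizer R t).
Proof.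
have bilinB (x y z : R) :
    (x - y) ** z = x ** z - y ** z /\ z ** (x - y) = z ** x - z ** y.
  by split; apply/eqP; rewrite eq_sym subr_eq -?rmulDl -?rmulDr subrK.
split=> [|x y].
  by have [] := bilinB 0 0 t; rewrite inE !subrr => -> ->.
rewrite !inE => /eqP cx /eqP cy.
by have [-> ->] := bilinB x y t; rewrite cx cy.
Qed.

(** The bound [|H + K| <= |G|], in the form of an injection of [H * K] into
    [G * (H :&: K)]: once a decomposition [g = h0 + k0] of each sum is
    chosen, [(h, k)] is determined by [g = h + k] and [h - h0 = k0 - k]. *)
Lemma leq_card_zmod_closedI (R : finRngType) (H K : {set R}) :
    zmod_closed H -> zmod_closed K ->
  (#|H| * #|K| <= #|[set: R]| * #|H :&: K|)%N.
Proof.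
move=> [_ HB] [_ KB].
(* The default value 0 is only taken outside [H + K]. *)
pose h0 (g : R) : R := odflt 0 [pick h in H | g - h \in K].
pose f (p : R * R) := (p.1 + p.2, p.1 - h0 (p.1 + p.2)).
have f_inj : injective f.
  move=> [h k] [h' k'] [/= eq_g eq_h]; move: eq_h; rewrite eq_g => /addIr eq_h.
  by move: eq_g; rewrite eq_h => /addrI ->.
rewrite -!cardsX -(card_imset _ f_inj); apply/subset_leq_card/subsetP.
move=> _ /imsetP[[h k] /setXP[Hh Kk] ->]; rewrite !inE /= /h0.
case: pickP => [h1 /andP[Hh1 Kh1] | /(_ h)] /=; last first.
  by rewrite Hh addrC addKr Kk.
rewrite HB //=; have -> : h - h1 = (h + k - h1) - k by rewrite addrAC addrK.
exact: KB.
Qed.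

Lemma card_commuting_pairs (R : finRngType) (S T : {set R}) :
  #|[set p in setX S T | p.1 ** p.2 == p.2 ** p.1]|
    = (\sum_(t in T) #|S :&: centralizer R t|)%N.
Proof.
under eq_bigr => t _ do rewrite -sum1_card.
rewrite (exchange_big_dep (mem S)) /=; last by move=> t s _ /setIP[].
rewrite pair_big_dep /= -sum1_card; apply: eq_bigl => -[s t].
by rewrite !inE /= -andbA; case: (s \in S); case: (t \in T).
Qed.

Lemma relPrC (R : finRngType) (S T : {set R}) : relPr S T = relPr T S.
Proof.
rewrite /relPr [_ * #|T|%:R]mulrC; congr (_%:R / _).
have swapK : involutive (fun p : R * R => (p.2, p.1)) by case.
rewrite -(card_imset _ (inv_inj swapK)); apply: eq_card => -[x y].
rewrite -{1}[(x, y)]swapK (mem_imset _ _ (inv_inj swapK)) !inE /=.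
by rewrite andbC eq_sym [in RHS]andbC [in RHS](andbC (x \in T)).
Qed.

Lemma relPr_setT_le (R : finRngType) (S T : {set R}) :
  zmod_closed S -> relPr [set: R] T <= relPr S T.
Proof.
move=> clS.
have S_gt0 : (0 < #|S|)%N by apply/card_gt0P; exists 0; case: clS.
have R_gt0 : (0 < #|[set: R]|)%N by apply/card_gt0P; exists 0; rewrite inE.
rewrite /relPr !card_commuting_pairs !invfM !mulrA.
apply: ler_wpM2r; first by rewrite invr_ge0 ler0n.
rewrite ler_pdivrMr ?ltr0n // mulrAC ler_pdivlMr ?ltr0n //.
rewrite -!natrM ler_nat !big_distrl /=; apply: leq_sum => t _.
rewrite setTI mulnC [leqRHS]mulnC.
exact/leq_card_zmod_closedI/centralizer_zmod_closed.
Qed.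

Theorem theorem2p2 (R : finRngType) (S : {set R}) (hS : subring S) :
  Pr [set: R] <= relPr S [set: R] /\ relPr S [set: R] <= Pr S.
Proof.
have [clS _] := hS.
split; first exact: relPr_setT_le.
by rewrite relPrC; exact: relPr_setT_le.
Qed.
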